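(* Let $(\mathsf M,\mathsf d)$ be a metric space whose metric $\mathsf d$ is a measure definite kernel with respect to a $\sigma$-finite measure space $(E,\mathcal E,\mu)$ and a family $\{A_x\}_{x\in\mathsf M}\subset\mathcal E$ with $\mu(A_x)<\infty$ for all $x\in\mathsf M$, that is, $$\mathsf d(x,y)=\mu(A_x\Delta A_y)\qquad\text{for all }x,y\in\mathsf M.$$ Then for all $\beta\in(0,1)$, $$\mathsf d^\beta(x,y)=\mu_\beta(A_x^*\Delta A_y^* )\qquad\text{for all }x,y\in\mathsf M,$$ where $A^*:=\{m\in\mathbb M_p(E): m(A)\text{ is odd}\}$ and $\mu_\beta$ is the measure on $\mathbb M_p(E)$ given by $$\mu_\beta(\cdot):=c_\beta\int_0^\infty r^{-\beta-1}\,\mathbb P'_{r,\mu}(\cdot)\,dr,\qquad c_\beta:=\frac{\beta2^{1-\beta}}{\Gamma(1-\beta)}.$$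
   Context: $\mathbb M_p(E)$ is the space of point measures $m=\sum_i\delta_{x_i}$ (countable sums, $x_i\in E$) on $(E,\mathcal E)$, equipped with the $\sigma$-algebra $\mathcal M_p(E)$ generated by the evaluation maps $m\mapsto m(A)$, $A\in\mathcal E$. For $r>0$, $\mathbb P'_{r,\mu}$ is the law on $(\mathbb M_p(E),\mathcal M_p(E))$ of the Poisson point process on $(E,\mathcal E)$ with mean measure $r\mu$; in particular $\mathbb P'_{r,\mu}(m(A)=k)=\frac{(r\mu(A))^k}{k!}e^{-r\mu(A)}$, $k=0,1,2,\dots$, for $A\in\mathcal E$ with $\mu(A)<\infty$. $\Delta$ denotes symmetric difference and $\mathsf d^\beta(x,y)=(\mathsf d(x,y))^\beta$. *)

(* Defs.v *)
From HB Require Import structures.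
From mathcomp Require Import all_boot all_order all_algebra.
From mathcomp Require Import all_classical all_reals all_analysis.
From mathcomp Require Import measurable_realfun.

Set Implicit Arguments.
Unset Strict Implicit.
Unset Printing Implicit Defensive.

Import Order.TTheory GRing.Theory Num.Theory.
Import numFieldNormedType.Exports.

Local Open Scope classical_set_scope.
Local Open Scope ring_scope.
Local Open Scope ereal_scope.

(* The index set D may be empty, finite or infinite, and x may repeat points
   (multiplicities). *)
Definition is_point_measure d (E : measurableType d) (R : realType)
    (m : set E -> \bar R) : Prop :=
  exists (D : set nat) (x : nat -> E),
    forall A, measurable A -> m A = \esum_(i in D) \d_(x i) A.

Record point_measure d (E : measurableType d) (R : realType) := PointMeasure {
  point_measure_val :> {measure set E -> \bar R} ;
  point_measureP : is_point_measure point_measure_val }.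

Arguments point_measure {d} E R.

Section point_measure_measurable.
Context d (E : measurableType d) (R : realType).

Local Notation Mp := (point_measure E R).

HB.instance Definition _ := gen_eqMixin Mp.
HB.instance Definition _ := gen_choiceMixin Mp.

Let mzero_point_measure : is_point_measure (@mzero d E R).
Proof. by exists set0, (fun=> point) => A _; rewrite esum_set0. Qed.

HB.instance Definition _ := isPointed.Build Mp (PointMeasure mzero_point_measure).

Definition point_measure_measurable : set (set Mp) :=
  <<s \bigcup_(A in @measurable d E)
        preimage_set_system [set: Mp] (fun m : Mp => m A) measurable >>.

Let point_measure_measurable0 : point_measure_measurable set0.
Proof. exact: sigma_algebra0. Qed.

Let point_measure_measurableC (U : set Mp) :
  point_measure_measurable U -> point_measure_measurable (~` U).
Proof. exact: sigma_algebraC. Qed.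

Let point_measure_measurableU (F : (set Mp)^nat) :
  (forall i, point_measure_measurable (F i)) ->
  point_measure_measurable (\bigcup_i F i).
Proof. exact: sigma_algebra_bigcup. Qed.

Definition point_measure_display : measure_display.
Proof. by constructor. Qed.

HB.instance Definition _ :=
  @isMeasurable.Build point_measure_display Mp point_measure_measurable
    point_measure_measurable0 point_measure_measurableC
    point_measure_measurableU.

End point_measure_measurable.

(* Subfamilies need no separate clause: take B i = setT for the omitted i. *)
Definition mutually_independent d (T : measurableType d) (R : realType)
    d' (T' : measurableType d') (P : probability T R) (n : nat)
    (X : 'I_n -> T -> T') : Prop :=
  forall B : 'I_n -> set T', (forall i, measurable (B i)) ->
    P (\bigcap_i (X i @^-1` B i)) = \prod_(i < n) P (X i @^-1` B i).

(* The library's poisson_pmf is not used because it takes the value 1 at every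
   k when the rate is 0; here rate 0 gives the unit mass at k = 0. *)
Definition is_poisson_point_law d (E : measurableType d) (R : realType)
    (nu : {measure set E -> \bar R})
    (P : probability (point_measure E R) R) : Prop :=
  [/\ forall (A : set E) (k : nat), measurable A -> nu A < +oo ->
        P [set m : point_measure E R | m A = k%:R%:E] =
          (fine (nu A) ^+ k / k`!%:R * expR (- fine (nu A)))%:E,
      forall A : set E, measurable A -> nu A = +oo ->
        P [set m : point_measure E R | m A = +oo] = 1
    & forall (n : nat) (A : 'I_n -> set E),
        (forall i, measurable (A i)) -> trivIset [set: 'I_n] A ->
        mutually_independent P (fun i (m : point_measure E R) => m (A i))].

Definition odd_event d (E : measurableType d) (R : realType) (A : set E) :
    set (point_measure E R) :=
  [set m : point_measure E R | exists2 k : nat, odd k & m A = k%:R%:E].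

Arguments odd_event {d E} R A.

Definition Gamma (R : realType) (a : R) : R :=
  (\int[lebesgue_measure]_(t in `]0, +oo[) (t `^ (a - 1) * expR (- t)))%R.

Definition c_beta (R : realType) (beta : R) : R :=
  (beta * 2 `^ (1 - beta) / Gamma (1 - beta))%R.

Definition mu_beta d (E : measurableType d) (R : realType) (beta : R)
    (P : R -> probability (point_measure E R) R)
    (B : set (point_measure E R)) : \bar R :=
  (c_beta beta)%:E *
  \int[lebesgue_measure]_(r in `]0%R, +oo[) ((r `^ (- beta - 1))%:E * P r B).

(* Main.v *)
(* [A^* `+` B^*] and [(A `+` B)^*] agree up to the null event that [m A] or
   [m B] is infinite, and a Poisson variable of parameter [l] is odd with
   probability [(1 - exp (- 2 l)) / 2].  Hence the identity reduces to
   [\int_0^oo r^(- b - 1) (1 - exp (- s r)) dr = s^b Gamma (1 - b) / b]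
   at [s = 2 d(x, y)].

   Integrating [P r B] over [r] gives a measure only if [P r B] is measurable
   in [r]; this is checked on events depending on the masses of a finite
   partition of [E], which are countable unions of events of explicit
   probability because point measures take values in [N u {+oo}], and extended
   by Dynkin's lemma. *)
Require Import Defs.
From HB Require Import structures.
From mathcomp Require Import all_boot all_order all_algebra.
From mathcomp Require Import all_classical all_reals all_analysis.
From mathcomp Require Import measurable_realfun.
From mathcomp Require Import ring.
Set Implicit Arguments.
Unset Strict Implicit.
Unset Printing Implicit Defensive.
Import Order.TTheory GRing.Theory Num.Theory.
Import numFieldNormedType.Exports.
Local Open Scope classical_set_scope.
Local Open Scope ring_scope.

(** * The integral representation of powers *)

Section power_integrals.
Context {R : realType}.
Local Notation mu := (@lebesgue_measure R).

Lemma continuous_powRr (p x : R) : 0 < x -> {for x, continuous (@powR R ^~ p)}.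
Proof.
move=> x0; apply: differentiable_continuous; apply/derivable1_diffP.
by apply: derivable_powR; rewrite in_itv/= x0.
Qed.

Lemma cvg_powRNy (b : R) : 0 < b -> r `^ (- b) @[r --> +oo] --> 0.
Proof.
move=> b0; apply: (@cvg_trans _ (expR (- (b * ln r)) @[r --> +oo])).
  apply: near_eq_cvg; near=> r.
  by rewrite /powR gt_eqF ?mulNr//; near: r; exact: nbhs_pinfty_gt.
apply: (@cvg_comp _ _ _ (fun r => b * ln r) (fun z => expR (- z)) _ +oo).
  apply: gt0_cvgMry => //; apply/cvgryPge => A; near=> r.
  rewrite -ler_expR lnK; first by near: r; exact: nbhs_pinfty_ge.
  by rewrite posrE; near: r; exact: nbhs_pinfty_gt.
exact: cvgr_expR.
Unshelve. all: by end_near. Qed.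

(** The integrand is the exponential density of rate [s], whose mass on [[0, r]] has a closed form;
    the endpoints are negligible. *)
Lemma integral_expR_itv0oo (s r : R) : 0 < r ->
  (\int[mu]_(u in `]0%R, r[) (s * expR (- s * u))%:E =
   (1 - expR (- s * r))%:E)%E.
Proof.
move=> r0; rewrite EFinB -(exponential_prob_itv0c s r0) /exponential_prob.
rewrite (@integral_itv_bndoo _ 0 r (EFin \o exponential_pdf s) true false);
  last first.
  by apply/measurable_EFinP/measurable_funTS; exact: measurable_exponential_pdf.
apply: eq_integral => u; rewrite inE/= in_itv/= => /andP[u0 _].
by rewrite /= exponential_pdfE ?(ltW u0).
Qed.

Lemma integral_powRy (b u : R) : 0 < b -> 0 < u ->
  (\int[mu]_(r in `]u, +oo[) (r `^ (- b - 1))%:E = (u `^ (- b) / b)%:E)%E.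
Proof.
move=> b0 u0; rewrite integral_itv_obnd_cbnd; last first.
  by apply/measurable_EFinP/measurable_funTS; exact: measurable_powR.
(* The antiderivative [- r^(-b) / b] tends to 0 at [+oo], so only its value at [u] contributes. *)
rewrite (@ge0_continuous_FTC2y _ _ (fun r => - b^-1 * r `^ (- b)) u 0).
- by rewrite sub0e -EFinN mulNr opprK mulrC.
- by move=> x _; exact: powR_ge0.
- apply/continuous_within_itvcyP; split.
    move=> x; rewrite in_itv/= andbT => ux.
    by apply: continuous_powRr; exact: lt_trans ux.
  by apply: cvg_at_right_filter; exact: continuous_powRr.
- by rewrite -(mulr0 (- b^-1)); apply: cvgM; [exact: cvg_cst|exact: cvg_powRNy].
- move=> x ux; apply: derivableM; first exact: derivable_cst.
  by apply: derivable_powR; rewrite in_itv/= andbT (lt_trans u0).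
- apply: cvgM; first exact: cvg_cst.
  by apply: cvg_at_right_filter; exact: continuous_powRr.
- move=> x; rewrite in_itv/= andbT => ux.
  have x0 : x \in `]0, +oo[ by rewrite in_itv/= andbT (lt_trans u0).
  rewrite derive1Ml; last exact: derivable_powR.
  by rewrite powR_derive1// mulrA mulrNN mulVf ?mul1r ?gt_eqF.
Qed.

(* Tonelli, writing [1 - e^(-sr)] as an integral over [0 < u < r]. *)
Lemma integral_powR_expR_tonelli (b s : R) : 0 < b -> 0 <= s ->
  (\int[mu]_(r in `]0%R, +oo[) (r `^ (- b - 1) * (1 - expR (- s * r)))%:E =
   \int[mu]_(u in `]0%R, +oo[) (u `^ (- b) / b * (s * expR (- s * u)))%:E)%E.
Proof.
move=> b0 s0.
(* The pair [z] is [(r, u)]. The indicator of [D] encodes [u] in []0, r[] for fixed [r], and [r] in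
   []u, +oo[] for fixed [u > 0]. *)
pose D := [set z : R * R | 0 < z.2 < z.1].
have mD : measurable D.
  have -> : D = (setT `&` snd @^-1` `]0, +oo[) `&`
      (setT `&` (fun z => z.1 - z.2) @^-1` `]0, +oo[).
    rewrite !setTI; apply/seteqP; split=> -[r u];
      rewrite /D/= !in_itv/= !andbT subr_gt0.
      by case/andP.
    by case=> -> ->.
  apply: measurableI; first exact: measurable_snd.
  exact: measurable_funB.
have mexp : measurable_fun setT (fun u : R => s * expR (- s * u)).
  apply: measurable_funM => //.
  apply: (measurableT_comp (@measurable_expR R)).
  exact: mulrl_measurable.

pose f (z : R * R) : \bar R :=
  ((z.1 `^ (- b - 1) * (s * expR (- s * z.2))) * \1_D z)%:E.
have mf : measurable_fun setT f.
  apply/measurable_EFinP; apply: measurable_funM; last exact: measurable_indic.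
  apply: measurable_funM.
    by apply: (measurableT_comp (measurable_powR _)); exact: measurable_fst.
  exact: (measurableT_comp mexp measurable_snd).
have f0 z : (0 <= f z)%E.
  by rewrite lee_fin !mulr_ge0// ?powR_ge0 ?expR_ge0.
rewrite [LHS]integral_mkcond [RHS]integral_mkcond.
transitivity (\int[mu]_r \int[mu]_u f (r, u))%E.
  apply: eq_integral => r _; rewrite patchE.
  case: ifPn => [|/negP]; rewrite inE/= in_itv/= andbT => r0; last first.
    apply/esym/integral0_eq => u _; rewrite /f /D indicE memNset ?mulr0//=.
    by case/andP => u0 ur; apply: r0; exact: lt_trans ur.
  rewrite EFinM -integral_expR_itv0oo// -ge0_integralZl_EFin//; last 3 first.
  - by move=> u _; rewrite lee_fin mulr_ge0 ?expR_ge0.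
  - by apply/measurable_EFinP; exact: measurable_funTS.
  - exact: powR_ge0.
  rewrite [LHS]integral_mkcond; apply: eq_integral => u _.
  rewrite patchE /f indicE -EFinM /=.
  have -> : (u \in `]0, r[%classic) = ((r, u) \in D).
    by apply: asbool_equiv_eq; rewrite /D/= in_itv.
  by case: ifPn; rewrite ?mulr1 ?mulr0.
apply: (etrans (@fubini_tonelli _ _ _ _ R mu mu f mf f0)).
apply: eq_integral => u _; rewrite patchE.
case: ifPn => [|/negP]; rewrite inE/= in_itv/= andbT => u0; last first.
  apply/integral0_eq => r _; rewrite /f /D indicE memNset ?mulr0//=.
  by case/andP.
(* In the swapped order the inner integral of [r^(-b-1)] over []u, +oo[] supplies the factor
   [u^(-b) / b]. *)
rewrite EFinM -integral_powRy// muleC -ge0_integralZl_EFin//; last 3 first.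
- by move=> r _; rewrite lee_fin powR_ge0.
- by apply/measurable_EFinP/measurable_funTS; exact: measurable_powR.
- by rewrite mulr_ge0 ?expR_ge0.
rewrite [RHS]integral_mkcond; apply: eq_integral => r _.
rewrite patchE /f indicE -EFinM /=.
have -> : (r \in `]u, +oo[%classic) = ((r, u) \in D).
  by apply: asbool_equiv_eq; rewrite /D/= in_itv/= u0 andbT.
by case: ifPn; rewrite ?mulr1 ?mulr0 1?mulrC.
Qed.

(** Closed half-lines stay away from a possible singularity of [h] at 0. The free constant [c]
    allows the two sides of a substitution [v = s * u] to be exhausted in step, with [c = 1] and
    [c = s]. *)
Lemma cvg_integral0y (c : R) (h : R -> R) : 0 < c ->
  {in `]0, +oo[, continuous h} -> (forall x, 0 < x -> 0 <= h x) ->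
  (\int[mu]_(u in `[(c / n.+1%:R)%R, +oo[) (h u)%:E
    @[n --> \oo] --> \int[mu]_(u in `]0%R, +oo[) (h u)%:E)%E.
Proof.
move=> c0 ch h0.
have cn0 n : 0 < c / n.+1%:R by rewrite divr_gt0.
have -> : `]0%R, +oo[%classic = \bigcup_n `[c / n.+1%:R, +oo[%classic :> set R.
  apply/seteqP; split=> x /=; rewrite in_itv/= andbT.
    move=> x0; have : `]0, +oo[%classic (x / c).
      by rewrite /= in_itv/= andbT divr_gt0.
    rewrite itvoyEbigcup => -[n _ /=].
    rewrite in_itv/= add0r andbT ler_pdivlMr// => nx.
    by exists n => //=; rewrite in_itv/= andbT mulrC.
  by case=> n _ /=; rewrite in_itv/= andbT; exact: lt_le_trans.
apply: ge0_nondecreasing_set_cvg_integral => //.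
- move=> n m nm; apply/subsetPset => x/=; rewrite !in_itv/= !andbT.
  apply: le_trans.
  by rewrite ler_pM2l// lef_pV2 ?posrE// ler_nat.
- move=> n; apply/measurable_EFinP.
  have mh : measurable_fun (`]0, +oo[%classic : set R) h.
    by apply: open_continuous_measurable_fun => //; exact/in_continuous_mksetP.
  apply: measurable_funS mh => //.
  by move=> x/=; rewrite !in_itv/= !andbT; exact: lt_le_trans.
- move=> n x /=; rewrite in_itv/= andbT => nx.
  by rewrite lee_fin h0// (lt_le_trans _ nx).
Qed.

(** The substitution [v = s * u] is made on [[e, +oo[], where [g] is continuous up to the endpoint
    of the image [[s * e, +oo[]; letting [e] tend to 0 gives the open half-line. *)
Lemma ge0_integral_scale0y (s : R) (g : R -> R) : 0 < s ->
  {in `]0, +oo[, continuous g} -> (forall x, 0 < x -> 0 <= g x) ->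
  (\int[mu]_(u in `]0%R, +oo[) (s * g (s * u))%:E =
   \int[mu]_(v in `]0%R, +oo[) (g v)%:E)%E.
Proof.
move=> s0 cg g0.
have cgs : {in `]0, +oo[, continuous (fun u => s * g (s * u))}.
  move=> u; rewrite in_itv/= andbT => u0.
  apply: cvgM; first exact: cvg_cst.
  apply: (@continuous_comp _ _ _ (fun u => s * u) g).
    by apply: continuousM; [exact: cvg_cst|exact: cvg_id].
  by apply: cg; rewrite in_itv/= andbT mulr_gt0.
have gs0 u : 0 < u -> 0 <= s * g (s * u).
  by move=> u0; rewrite mulr_ge0 ?(ltW s0)// g0 ?mulr_gt0.
have limgs := cvg_integral0y ltr01 cgs gs0.
have limg := cvg_integral0y s0 cg g0.
rewrite -(cvg_lim _ limgs)// -(cvg_lim _ limg)//; congr (lim (_ @ \oo)).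
apply/funext => n; rewrite mul1r; set e := n.+1%:R^-1.
have e0 : 0 < e by rewrite invr_gt0.
have dsu u : derivable (fun u => s * u) u 1 by apply: derivableM.
have dsuE : derive1 (fun u : R => s * u) = cst s.
  by apply/funext => u; rewrite derive1Ml// derive1_id mulr1.
rewrite (@increasing_ge0_integration_by_substitutiony _ (fun u => s * u)).
- by apply: eq_integral => u _ /=; rewrite dsuE /= mulrC.
- by move=> x y _ _ xy; rewrite ltr_pM2l.
- by move=> x _; rewrite dsuE; exact: cvg_cst.
- by rewrite dsuE; exact: is_cvg_cst.
- by rewrite dsuE; exact: is_cvg_cst.
- split; first by move=> x _; exact: dsu.
  apply: cvg_at_right_filter; apply: cvgM; [exact: cvg_cst|exact: cvg_id].
- by apply: gt0_cvgMry => //; exact: cvg_id.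
- have se0 : 0 < s * e by rewrite mulr_gt0.
  apply/continuous_within_itvcyP; split.
    move=> x; rewrite in_itv/= andbT => /(lt_trans se0) x0.
    by apply: cg; rewrite in_itv/= andbT.
  by apply: cvg_at_right_filter; apply: cg; rewrite in_itv/= andbT.
- move=> x; rewrite in_itv/= andbT => sex; apply: g0.
  by apply: lt_trans sex; rewrite mulr_gt0.
Qed.

(** * Convergence and positivity of the Gamma integral *)

Lemma gamma_integrand_ge0 (a x : R) : 0 <= x `^ (a - 1) * expR (- x).
Proof. by rewrite mulr_ge0 ?powR_ge0 ?expR_ge0. Qed.

Lemma continuous_gamma_integrand (a : R) :
  {in `]0, +oo[, continuous (fun x => x `^ (a - 1) * expR (- x))}.
Proof.
move=> x; rewrite in_itv/= andbT => x0; apply: cvgM.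
  exact: continuous_powRr.
apply: continuous_comp; last exact: continuous_expR.
exact: continuousN.
Qed.

Lemma measurable_gamma_integrand (a : R) (D : set R) :
  measurable_fun D (fun x => (x `^ (a - 1) * expR (- x))%:E).
Proof.
apply/measurable_EFinP/measurable_funTS; apply: measurable_funM.
  exact: measurable_powR.
by apply: (measurableT_comp (@measurable_expR R)); exact: oppr_measurable.
Qed.

(** Below 1 the integrand is at most [t^(a-1)], which contributes at most [1/a]. Above 1 it is at
    most [e^(-t)] because [a < 1], which contributes at most 1. *)
Lemma integral_gamma_lty (a : R) : 0 < a -> a < 1 ->
  (\int[mu]_(t in `]0%R, +oo[) (t `^ (a - 1) * expR (- t))%:E < +oo)%E.
Proof.
move=> a0 a1.
have gE x (_ : 0 < x) := gamma_integrand_ge0 a x.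
have cg := @continuous_gamma_integrand a.
have mg D := @measurable_gamma_integrand a D.
apply: (@le_lt_trans _ _ (a^-1 + 1)%:E); last exact: ltry.
apply: (cvge_to_le (cvg_integral0y ltr01 cg gE)).
apply: nearW => n; rewrite mul1r; set e := n.+1%:R^-1.
have e0 : 0 < e by rewrite invr_gt0.
have e1 : e <= 1 by rewrite invf_le1 ?ler1n.
have -> : `[e, +oo[%classic = `[e, 1%R[%classic `|` `[1%R, +oo[%classic.
  by rewrite -itv_bndbnd_setU.
rewrite ge0_integral_setU//=; last 3 first.
  exact: mg.
  by move=> x _; exact: gamma_integrand_ge0.
  apply: lt_disjoint => x y; rewrite !in_itv/= andbT => /andP[_ x1] y1.
  exact: lt_le_trans y1.
rewrite EFinD leeD//.
  (* For [n = 0] the endpoint [e] is 1 and the interval is empty; the fundamental theorem of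
     calculus is applied for [e < 1]. *)
  have [e1'|e1'] := boolP (e < 1); last first.
    have -> : e = 1 by apply/eqP; rewrite eq_le e1 leNgt.
    by rewrite set_itvco0 integral_set0 lee_fin invr_ge0 ltW.
  apply: (@le_trans _ _ (\int[mu]_(x in `[e, 1%R]) (x `^ (a - 1))%:E)%E).
    apply: (@le_trans _ _ (\int[mu]_(x in `[e, 1%R])
        (x `^ (a - 1) * expR (- x))%:E)%E).
      apply: ge0_subset_integral => //; first exact: mg.
        by move=> x _; exact: gamma_integrand_ge0.
      by move=> x /=; rewrite !in_itv/= => /andP[-> /ltW].
    apply: ge0_le_integral => //.
    - by move=> x _; exact: gamma_integrand_ge0.
    - exact: mg.
    - by apply/measurable_EFinP/measurable_funTS; exact: measurable_powR.
    - move=> x /=; rewrite in_itv/= => /andP[ex _]; rewrite lee_fin.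
      rewrite ler_piMr ?powR_ge0// -expR0 ler_expR oppr_le0.
      exact: ltW (lt_le_trans e0 ex).
  rewrite (@continuous_FTC2 _ _ (fun x => a^-1 * x `^ a))//.
  - rewrite powR1 mulr1 -EFinB lee_fin gerBl mulr_ge0 ?powR_ge0//.
    by rewrite invr_ge0 ltW.
  - apply/continuous_within_itvP => //; split.
    + move=> x; rewrite in_itv/= => /andP[ex _].
      by apply: continuous_powRr; exact: lt_trans ex.
    + by apply: cvg_at_right_filter; exact: continuous_powRr.
    + by apply: cvg_at_left_filter; exact: continuous_powRr.
  - split.
    + move=> x; rewrite in_itv/= => /andP[ex _].
      apply: derivableM; first exact: derivable_cst.
      by apply: derivable_powR; rewrite in_itv/= andbT (lt_trans e0).
    + apply: cvgM; first exact: cvg_cst.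
      by apply: cvg_at_right_filter; exact: continuous_powRr.
    + apply: cvgM; first exact: cvg_cst.
      by apply: cvg_at_left_filter; exact: continuous_powRr.
  - move=> x; rewrite in_itv/= => /andP[ex _].
    have x0 : x \in `]0, +oo[ by rewrite in_itv/= andbT (lt_trans e0).
    rewrite derive1Ml; last exact: derivable_powR.
    by rewrite powR_derive1// mulrA mulVf ?mul1r ?gt_eqF.
have mpdf (D : set R) : measurable_fun D (fun x => (exponential_pdf 1 x)%:E).
  by apply/measurable_EFinP/measurable_funTS; exact: measurable_exponential_pdf.
have pdf0 (x : R) : (0 <= (exponential_pdf 1 x)%:E)%E.
  by rewrite lee_fin exponential_pdf_ge0.
(* The bound 1 is read as the total mass of the exponential density of rate 1. *)
rewrite -(integral_exponential_pdf (ltr01 : 0 < 1 :> R)).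
apply: (@le_trans _ _ (\int[mu]_(x in `[1%R, +oo[) (exponential_pdf 1 x)%:E)%E).
  apply: ge0_le_integral => //.
  - by move=> x _; exact: gamma_integrand_ge0.
  - exact: mg.
  - exact: mpdf.
  - move=> x /=; rewrite in_itv/= andbT => x1; rewrite lee_fin.
    rewrite exponential_pdfE ?(le_trans _ x1)// mul1r mulN1r.
    rewrite ler_piMl ?expR_ge0// -[leRHS](powRr0 x) ler_powR//.
    by rewrite subr_le0 ltW.
by apply: ge0_subset_integral => //; exact: mpdf.
Qed.

(** On [[1, 2]], [a >= 0] gives [t^(a-1) >= 1/t >= 1/2], and [e^(-t) >= e^(-2)]. Positivity is what
    makes the division by Gamma in [c_beta] meaningful. *)
Lemma integral_gamma_gt0 (a : R) : 0 <= a ->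
  (0 < \int[mu]_(t in `]0%R, +oo[) (t `^ (a - 1) * expR (- t))%:E)%E.
Proof.
move=> a0.
have mg D := @measurable_gamma_integrand a D.
apply: (@lt_le_trans _ _
  (\int[mu]_(t in `[1%R, 2%R]) (cst (2^-1 * expR (- 2))%:E t))%E).
  rewrite integral_cst//= lebesgue_measure_itv/= lte_fin ltr1n -EFinB.
  rewrite -EFinM lte_fin !mulr_gt0 ?invr_gt0 ?expR_gt0//.
apply: (@le_trans _ _
  (\int[mu]_(t in `[1%R, 2%R]) (t `^ (a - 1) * expR (- t))%:E)%E).
  apply: ge0_le_integral => //.
  - by move=> x _; rewrite lee_fin mulr_ge0 ?invr_ge0 ?expR_ge0.
  - exact: mg.
  - move=> x /=; rewrite in_itv/= => /andP[x1 x2]; rewrite lee_fin.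
    have x0 : 0 < x by exact: lt_le_trans x1.
    apply: ler_pM; rewrite ?invr_ge0 ?expR_ge0// ?ler_expR ?lerN2//.
    apply: (@le_trans _ _ (x `^ (-1))); last first.
      by rewrite ler_powR// lerBrDr addrC subrr.
    by rewrite powR_inv1 ?(ltW x0)// lef_pV2 ?posrE.
apply: ge0_subset_integral => //.
- exact: mg.
- by move=> x _; exact: gamma_integrand_ge0.
move=> x /=; rewrite !in_itv/= andbT => /andP[x1 _].
exact: lt_le_trans x1.
Qed.

(** [Gamma] is the [fine] of an extended integral, which sends [+oo] to 0; convergence ensures that
    no value is lost. *)
Lemma EFin_Gamma (b : R) : 0 < b < 1 ->
  (\int[mu]_(t in `]0%R, +oo[) (t `^ (1 - b - 1) * expR (- t))%:E =
    (Gamma (1 - b))%:E)%E.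
Proof.
move=> /andP[b0 b1]; rewrite /Gamma /Rintegral fineK// ge0_fin_numE.
  by apply: integral_gamma_lty; rewrite ?subr_gt0// gtrBl.
by apply: integral_ge0 => t _; exact: gamma_integrand_ge0.
Qed.

Lemma Gamma_gt0 (b : R) : 0 < b < 1 -> 0 < Gamma (1 - b).
Proof.
move=> b01; rewrite -lte_fin -EFin_Gamma// integral_gamma_gt0//.
by case/andP: b01 => _ /ltW; rewrite subr_ge0.
Qed.

(** After Tonelli, [s * u^(-b) * e^(-su)] equals [s^b] times [s * g(s * u)], where [g] is the
    integrand of Gamma at [1 - b]; rescaling then removes [s]. *)
Lemma integral_powR_expR (b s : R) : 0 < b < 1 -> 0 <= s ->
  (\int[mu]_(r in `]0%R, +oo[) (r `^ (- b - 1) * (1 - expR (- s * r)))%:E =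
   (s `^ b * Gamma (1 - b) / b)%:E)%E.
Proof.
move=> b01 s0; have /andP[b0 b1] := b01.
(* The rescaling requires [s > 0]. At [s = 0] both sides vanish, with [0^b = 0] because [b > 0]. *)
have [->|sN0] := eqVneq s 0.
  rewrite powR0 ?gt_eqF// !mul0r integral0_eq// => r _.
  by rewrite oppr0 mul0r expR0 subrr mulr0.
have {sN0}s0' : 0 < s by rewrite lt_neqAle eq_sym sN0.
rewrite integral_powR_expR_tonelli//.
have gE x (_ : 0 < x) := gamma_integrand_ge0 (1 - b) x.
have cg := @continuous_gamma_integrand (1 - b).
rewrite mulrAC EFinM -EFin_Gamma// -(ge0_integral_scale0y s0' cg gE).
rewrite -ge0_integralZl_EFin//; last 3 first.
- move=> x /=; rewrite in_itv/= andbT => x0.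
  by rewrite lee_fin mulr_ge0// gE// mulr_gt0.
- apply/measurable_EFinP/measurable_funTS; apply: measurable_funM => //.
  apply: measurable_funM.
    apply: (measurableT_comp (measurable_powR _)); exact: mulrl_measurable.
  apply: (measurableT_comp (@measurable_expR R)).
  by apply: (measurableT_comp (@oppr_measurable R _)); exact: mulrl_measurable.
- by rewrite divr_ge0 ?powR_ge0 ?ltW.
apply: eq_integral => u; rewrite inE/= in_itv/= andbT => u0.
rewrite -EFinM; congr EFin.
have -> : 1 - b - 1 = - b by rewrite addrAC subrr add0r.
rewrite powRM ?ltW// mulNr.
have : s `^ b * s `^ (- b) = 1.
  by rewrite powRN mulfV// gt_eqF ?powR_gt0.
move=> e.
transitivity
  ((s `^ b * s `^ (- b)) * (u `^ (- b) / b * (s * expR (- (s * u))))).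
  by rewrite e mul1r.
by rewrite -!mulrA; ring.
Qed.
End power_integrals.

(** * Poisson point laws *)

(** The possible masses N u {+oo} are coded by the countable type [option nat], so that finite
    vectors of masses can be enumerated. *)
Definition ext_nat (R : realType) (o : option nat) : \bar R :=
  if o is Some k then k%:R%:E else +oo%E.

Lemma ext_nat_inj (R : realType) : injective (@ext_nat R).
Proof. by case=> [k|] [l|]// [] /eqP; rewrite eqr_nat => /eqP ->. Qed.

Section point_measure.
Context d (E : measurableType d) (R : realType).
Local Notation Mp := (point_measure E R).

(** The mass of [A] counts the indices [i] in [D] with [x i] in [A]: a cardinal if there are
    finitely many, [+oo] otherwise. *)
Lemma point_measure_ext_nat (m : Mp) (A : set E) : measurable A ->
  exists o, m A = ext_nat R o.
Proof.
move=> mA; case: (point_measureP m) => D [x /(_ _ mA) ->].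
have -> : \esum_(i in D) \d_(x i) A =
    \esum_(i in D `&` x @^-1` A) 1%E :> \bar R.
  rewrite esum_mkcondr; apply: eq_esum => i _.
  rewrite diracE (_ : (i \in x @^-1` A) = (x i \in A)); first by case: ifP.
  exact: asbool_equiv_eq.
have [fD|iD] := pselect (finite_set (D `&` x @^-1` A)).
  exists (Some (size (finmap.enum_fset (fset_set (D `&` x @^-1` A))))).
  by rewrite finite_card_sum.
exists None; rewrite /= -(@infinite_card_dirac _ nat R _ iD).
by apply: eq_esum => i iDA; rewrite diracE mem_set.
Qed.

Lemma measurable_point_measure_eval (A : set E) : measurable A ->
  measurable_fun setT (fun m : Mp => m A).
Proof.
move=> mA _ Y mY; rewrite setTI; apply: sub_sigma_algebra.
by exists A => //; exists Y => //; rewrite setTI.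
Qed.

Lemma measurable_point_measure_eq (A : set E) (y : \bar R) : measurable A ->
  measurable [set m : Mp | m A = y].
Proof.
move=> mA; rewrite -[X in measurable X]setTI.
exact: (measurable_point_measure_eval mA measurableT (emeasurable_set1 y)).
Qed.

Lemma odd_event_bigcup (A : set E) : odd_event R A =
  \bigcup_(k in [set k | odd k]) [set m : Mp | m A = k%:R%:E].
Proof. by apply/seteqP; split => m [k ok mk]; exists k. Qed.

Lemma measurable_odd_event (A : set E) : measurable A ->
  measurable (odd_event R A).
Proof.
move=> mA; rewrite odd_event_bigcup.
by apply: bigcup_measurable => k _; exact: measurable_point_measure_eq.
Qed.
End point_measure.

(** * Series of Poisson probabilities *)

Section exp_series.
Context {R : realType}.
Implicit Type l : R.

Lemma cvg_series_exp_coeff l : series (exp_coeff l) @ \oo --> expR l.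
Proof. exact: is_cvg_series_exp_coeff. Qed.

Definition poisson_mass l (k : nat) : R := l ^+ k / k`!%:R * expR (- l).

Lemma poisson_mass_series l : 0 <= l ->
  (\sum_(0 <= k <oo) (poisson_mass l k)%:E = 1)%E.
Proof.
move=> l0; apply/cvg_lim => //.
rewrite (_ : (fun _ => _) =
    EFin \o (fun n => series (exp_coeff l) n * expR (- l))).
  apply: cvg_EFin; first by near=> n.
  rewrite (_ : 1 = expR l * expR (- l)); last by rewrite -expRD subrr expR0.
  by apply: cvgM; [exact: cvg_series_exp_coeff|exact: cvg_cst].
by apply/funext => n /=; rewrite sumEFin mulr_suml.
Unshelve. all: by end_near. Qed.

(** The odd part of the exponential series is [(e^l - e^(-l)) / 2]; it is then multiplied by
    [e^(-l)]. *)
Lemma poisson_mass_odd_series l : 0 <= l ->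
  (\sum_(0 <= k <oo | odd k) (poisson_mass l k)%:E =
   ((1 - expR (- 2 * l)) / 2)%:E)%E.
Proof.
move=> l0; apply/cvg_lim => //.
rewrite (_ : (fun _ => _) = EFin \o (fun n =>
    (series (exp_coeff l) n - series (exp_coeff (- l)) n) * (expR (- l) / 2))).
  apply: cvg_EFin; first by near=> n.
  rewrite (_ : (1 - expR (-2 * l)) / 2 =
      (expR l - expR (- l)) * (expR (- l) / 2)).
    apply: cvgM; last exact: cvg_cst.
    by apply: cvgB; exact: cvg_series_exp_coeff.
  have -> : -2 * l = - l + - l by ring.
  have h : expR l * expR (- l) = 1 by rewrite -expRD subrr expR0.
  by rewrite [RHS]mulrA [in RHS]mulrBl h expRD.
apply/funext => n /=; rewrite sumEFin; congr EFin.
(* Termwise, [1 - (-1)^k] is 2 for odd [k] and 0 for even [k]. *)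
rewrite big_mkcond/= /series/= -sumrB mulr_suml; apply: eq_bigr => k _.
rewrite /exp_coeff/= exprNn -signr_odd /poisson_mass.
by case: (odd k); rewrite ?expr1 ?expr0 /=; field.
Unshelve. all: by end_near. Qed.
End exp_series.

(** The Poisson distribution of mean [y], extended to [y = +oo] by the unit mass at [+oo], so that
    cells of finite and infinite mean are handled alike. *)
Definition poisson_law (R : realType) (y : \bar R) (o : option nat) : R :=
  match o with
  | Some k => if (y < +oo)%E then poisson_mass (fine y) k else 0
  | None => (~~ (y < +oo)%E)%:R
  end.

Section poisson_point_law.
Context d (E : measurableType d) (R : realType).
Local Notation Mp := (point_measure E R).
Variables (nu : {measure set E -> \bar R}) (P : probability Mp R).
Hypothesis nuP : is_poisson_point_law nu P.

Lemma poisson_point_lawE (A : set E) (o : option nat) : measurable A ->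
  P [set m : Mp | m A = ext_nat R o] = (poisson_law (nu A) o)%:E.
Proof.
move=> mA; have [fin_law inf_law _] := nuP.
have meq := @measurable_point_measure_eq _ E R A.
have [nuA|nuA] := boolP (nu A < +oo)%E; last first.
  have PA1 : P [set m : Mp | m A = +oo%E] = 1%E.
    by apply: inf_law => //; apply/eqP; rewrite -leye_eq leNgt.
  case: o => [k|] /=; rewrite (negbTE nuA)//.
  apply/eqP; rewrite eq_le measure_ge0 andbT.
  (* A finite value of [m A] lies in the complement of an almost sure event. *)
  apply: (@le_trans _ _ (P (~` [set m : Mp | m A = +oo%E]))); last first.
    by rewrite probability_setC ?PA1 ?subee//; exact: meq.
  apply: le_measure; rewrite ?inE;
    [exact: meq|by apply: measurableC; exact: meq|].
  by move=> m /= ->.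
case: o => [k|] /=; rewrite nuA; first exact: fin_law.
(* The finite values already carry total mass 1, so the value [+oo] gets probability 0. *)
rewrite (_ : [set m : Mp | m A = +oo%E] =
    ~` \bigcup_k [set m : Mp | m A = k%:R%:E]).
  rewrite probability_setC; last by apply: bigcup_measurable => k _; exact: meq.
  rewrite measure_semi_bigcup; last 3 first.
  - by move=> k; exact: meq.
  - by move=> k l _ _ [m /= [-> /eqP]]; rewrite eqe eqr_nat => /eqP.
  - by apply: bigcup_measurable => k _; exact: meq.
  rewrite (eq_eseriesr (g := fun k => (poisson_mass (fine (nu A)) k)%:E)).
    by rewrite poisson_mass_series ?fine_ge0// subee.
  by move=> k _; exact: fin_law.
apply/seteqP; split=> m /=; first by move=> mAoo [k _ /=]; rewrite mAoo.
by have [[k|] //] := point_measure_ext_nat m mA => mAk [];exists k.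
Qed.

(** This is independence tested on singletons, transported from ordinals to [J] by [enum_val]. A
    general finite index type accommodates the product indices of a common refinement. *)
Lemma poisson_point_law_joint (J : finType) (C : J -> set E)
    (k : J -> option nat) :
  (forall i, measurable (C i)) -> trivIset setT C ->
  P [set m : Mp | forall i, m (C i) = ext_nat R (k i)] =
  (\prod_i poisson_law (nu (C i)) (k i))%:E.
Proof.
move=> mC tC; have [_ _ indep] := nuP.
pose D (j : 'I_#|J|) := C (enum_val j).
have tD : trivIset setT D.
  by move=> i j _ _ /(tC _ _ I I); exact: enum_val_inj.
have := indep _ D (fun j => mC (enum_val j)) tD
  (fun j => [set ext_nat R (k (enum_val j))]) (fun j => emeasurable_set1 _).
rewrite (_ : \bigcap_ _ _ = [set m : Mp | forall i, m (C i) = ext_nat R (k i)]).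
  move=> ->; rewrite -prodEFin (reindex (@enum_val J J)) /=; last first.
    exact: onW_bij (enum_val_bij _).
  by apply: eq_bigr => j _; rewrite -poisson_point_lawE.
apply/seteqP; split=> m /= mk i; last by move=> _; exact: mk.
by have := mk (enum_rank i) I; rewrite /= /D enum_rankK.
Qed.
End poisson_point_law.

(** * Measurability in the intensity *)

Lemma measurable_poisson_law (R : realType) (y : \bar R) (o : option nat) :
  (0 <= y)%E ->
  measurable_fun (`]0, +oo[%classic : set R)
    (fun r : R => poisson_law (r%:E * y)%E o).
Proof.
case: y => [l||]// l0.
  case: o => [k|]/=; last first.
    rewrite (_ : (fun _ => _) = cst 0)//.
    by apply/funext => r; rewrite -EFinM ltry.
  rewrite (_ : (fun _ => _) = (fun r => poisson_mass (r * l) k)); last first.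
    by apply/funext => r; rewrite -EFinM ltry.
  have ml : measurable_fun (`]0, +oo[%classic : set R) (fun r => r * l).
    exact: mulrr_measurable.
  apply: measurable_funM.
    by apply: measurable_funM => //; exact: measurable_funX.
  apply: (measurableT_comp (@measurable_expR R)).
  exact: (measurableT_comp (@oppr_measurable R _)).
(* For [r > 0] the mean [r * +oo] is [+oo], so the law does not vary with [r]. *)
apply: (eq_measurable_fun (cst (poisson_law +oo o))) => // r.
by rewrite inE/= in_itv/= andbT => r0; rewrite gt0_muley.
Qed.

(** Disjoint cells have independent masses, and cells covering [E] can be refined without losing
    mass. [Q] is an arbitrary set: only countably many vectors of masses occur. *)
Definition finite_dim_event d (E : measurableType d) (R : realType) :
    set (set (point_measure E R)) :=
  [set U | exists (J : finType) (C : J -> set E) (Q : set (J -> \bar R)),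
    [/\ forall j, measurable (C j), trivIset setT C, \bigcup_j C j = setT
      & U = [set m : point_measure E R | Q (fun j => m (C j))]]].

Section finite_dim_event.
Context d (E : measurableType d) (R : realType).
Local Notation Mp := (point_measure E R).

Lemma finite_dim_event_setI : setI_closed (@finite_dim_event d E R).
Proof.
move=> _ _ [J [C [Q [mC tC CT ->]]]] [K [D [S [mD tD DT ->]]]].
(* The common refinement has cells [C j] meet [D k]; summing over one index recovers the masses of
   the original cells. *)
exists (J * K)%type, (fun jk => C jk.1 `&` D jk.2), [set f |
  Q (fun j => \sum_(k \in setT) f (j, k))%E /\
  S (fun k => \sum_(j \in setT) f (j, k))%E].
split.
- by move=> jk; exact: measurableI.
- move=> [j k] [j' k'] _ _ [x /= [[Cj Dk] [Cj' Dk']]].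
  by congr (_, _); [apply: tC => //; exists x|apply: tD => //; exists x].
- rewrite -subTset => x _.
  have [j _ Cj] : (\bigcup_j C j) x by rewrite CT.
  have [k _ Dk] : (\bigcup_k D k) x by rewrite DT.
  by exists (j, k).
have mE (m : Mp) : (fun j => m (C j)) =
    (fun j => \sum_(k \in setT) m (C j `&` D k))%E.
  apply/funext => j; rewrite -measure_fin_bigcup//.
  - by rewrite -setI_bigcupr DT setIT.
  - exact: finite_finset.
  - exact: trivIset_setIl.
  - by move=> k _; exact: measurableI.
have mE' (m : Mp) : (fun k => m (D k)) =
    (fun k => \sum_(j \in setT) m (C j `&` D k))%E.
  apply/funext => k; rewrite -measure_fin_bigcup//.
  - by rewrite -setI_bigcupl CT setTI.
  - exact: finite_finset.
  - exact: trivIset_setIr.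
  - by move=> j _; exact: measurableI.
by apply/seteqP; split=> m /=; rewrite mE mE'.
Qed.

Let cylinder (J : finType) (C : J -> set E) (k : {ffun J -> option nat}) :=
  [set m : Mp | forall j, m (C j) = ext_nat R (k j)].

Let measurable_cylinder (J : finType) (C : J -> set E) k :
  (forall j, measurable (C j)) -> measurable (cylinder C k).
Proof.
move=> mC; rewrite (_ : cylinder C k =
    \bigcap_(j in setT) [set m : Mp | m (C j) = ext_nat R (k j)]).
  by apply: fin_bigcap_measurable => // j _; exact: measurable_point_measure_eq.
by apply/seteqP; split=> m; [move=> mk j _; exact: mk|move=> mk j; exact: mk].
Qed.

(** The event is split according to the vector of masses. These vectors are taken as finite
    functions, a countable type whose [pickle] codes index the union. *)
Lemma finite_dim_event_bigcup (J : finType) (C : J -> set E)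
    (Q : set (J -> \bar R)) :
  (forall j, measurable (C j)) ->
  exists (N : set nat) (k : nat -> J -> option nat),
  let F n := [set m : Mp | forall j, m (C j) = ext_nat R (k n j)] in
  [/\ trivIset N F, (forall n, measurable (F n))
    & [set m : Mp | Q (fun j => m (C j))] = \bigcup_(n in N) F n].
Proof.
move=> mC.
pose N : set nat := [set n | exists k : {ffun J -> option nat},
  pickle_inv n = Some k /\ Q (fun j => ext_nat R (k j))].
(* The default vector is used only at integers that code nothing, which lie outside [N]. *)
pose kk n : {ffun J -> option nat} := odflt [ffun=> None] (pickle_inv n).
exists N, kk => F.
split.
- move=> n n' [k [nk _]] [k' [nk' _]] [m []].
  rewrite /F /kk /= nk nk' /= => mk mk'.
  have kk' : k = k' by apply/ffunP => j; apply: (@ext_nat_inj R); rewrite -mk.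
  have := @pickle_invK {ffun J -> option nat} n.
  have := @pickle_invK {ffun J -> option nat} n'.
  by rewrite /oapp nk nk' /= kk' => -> ->.
- by move=> n; exact: measurable_cylinder.
apply/seteqP; split=> m /=.
  move=> Qm; have /choice[k mk] : forall j, exists o, m (C j) = ext_nat R o.
    by move=> j; exact: point_measure_ext_nat.
  have mk' j : m (C j) = ext_nat R ([ffun j => k j] j) by rewrite ffunE.
  exists (pickle [ffun j => k j]).
    exists [ffun j => k j]; rewrite pickleK_inv; split => //.
    by move: Qm; congr Q; apply/funext => j; rewrite -mk'.
  by rewrite /F /kk/= pickleK_inv.
case=> n [k [nk Qk]]; rewrite /F /kk /= nk /= => mk.
by move: Qk; congr Q; apply/funext => j; rewrite mk.
Qed.

Lemma measurable_finite_dim_eventE :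
  @measurable _ Mp = <<s @finite_dim_event d E R >>.
Proof.
apply/seteqP; split; apply: smallest_sub; try exact: smallest_sigma_algebra.
  move=> _ [A mA [B mB <-]]; apply: sub_sigma_algebra.
  (* A generator constrains the mass of one set [A], so the two-cell partition into [A] and its
     complement suffices. *)
  exists bool, (fun b => if b then A else ~` A), [set f | B (f true)]; split.
  - by case=> //; exact: measurableC.
  - by move=> [] [] _ _ // [x []].
  - rewrite -subTset => x _.
    by have [Ax|nAx] := pselect (A x); [exists true|exists false].
  - by rewrite setTI.
move=> _ [J [C [Q [mC _ _ ->]]]].
have [N [k [_ mF ->]]] := finite_dim_event_bigcup Q mC.
by apply: bigcup_measurable => n _; exact: mF.
Qed.

End finite_dim_event.

(** * The mixture of Poisson laws as a measure *)

Section mixture.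
Context d (E : measurableType d) (R : realType).
Local Notation Mp := (point_measure E R).
Variables (mu : {measure set E -> \bar R}) (P : R -> probability Mp R).
Hypothesis P_poisson : forall (r : R) (r0 : 0 < r),
  is_poisson_point_law (mscale (NngNum (ltW r0)) mu) (P r).

Lemma measurable_poisson_prob_event (B : set Mp) : measurable B ->
  measurable_fun (`]0, +oo[%classic : set R) (fun r => P r B).
Proof.
move=> mB; have : <<s @finite_dim_event d E R >> B.
  by rewrite -measurable_finite_dim_eventE.
move: B {mB}; apply: (dynkin_induction (measurable_finite_dim_eventE E R)).
- exact: finite_dim_event_setI.
- by apply: (eq_measurable_fun (cst 1%E)) => // r _; rewrite probability_setT.
- move=> _ [J [C [Q [mC tC _ ->]]]].
  have [N [k [tF mF ->]]] := finite_dim_event_bigcup Q mC.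
  rewrite (_ : (fun _ => _) = (fun r => \sum_(0 <= n <oo | n \in N)
      P r [set m : Mp | forall j, m (C j) = ext_nat R (k n j)])%E); last first.
    by apply/funext => r; rewrite measure_bigcup.
  apply: ge0_emeasurable_sum => // n _.
  (* For [r > 0], independence makes the probability of a cylinder a finite product of explicit
     functions of [r]. *)
  apply: (eq_measurable_fun
    (EFin \o (fun r : R => \prod_j poisson_law (r%:E * mu (C j))%E (k n j)))).
    move=> r; rewrite inE/= in_itv/= andbT => r0.
    by rewrite (poisson_point_law_joint (P_poisson r0)).
  apply/measurable_EFinP; apply: measurable_prod => j _.
  exact: measurable_poisson_law.
- move=> S mS PS; apply: (eq_measurable_fun (fun r => 1 - P r S)%E).
    by move=> r _; rewrite probability_setC.
  exact: emeasurable_funB.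
- move=> F mF tF PF.
  rewrite (_ : (fun _ => _) = (fun r => \sum_(0 <= n <oo) P r (F n))%E);
    last first.
    apply/funext => r; rewrite measure_semi_bigcup//.
    exact: bigcupT_measurable.
  exact: ge0_emeasurable_sum.
Qed.

(** Countable additivity comes from exchanging a nonnegative series with the integral over [r],
    which rests on the measurability of [P r B] in [r]. *)
Lemma mu_beta_measure (beta : R) : 0 <= c_beta beta ->
  exists nu : {measure set Mp -> \bar R},
    forall B, measurable B -> nu B = mu_beta beta P B.
Proof.
move=> c0.
have w0 (r : R) : (0 <= (r `^ (- beta - 1))%:E)%E by rewrite lee_fin powR_ge0.
have mw (B : set Mp) : measurable B ->
    measurable_fun (`]0, +oo[%classic : set R)
      (fun r => (r `^ (- beta - 1))%:E * P r B)%E.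
  move=> mB; apply: emeasurable_funM; last exact: measurable_poisson_prob_event.
  by apply/measurable_EFinP/measurable_funTS; exact: measurable_powR.
have nu0 : mu_beta beta P set0 = 0%E.
  rewrite /mu_beta integral0_eq ?mule0// => r _.
  by rewrite measure0 mule0.
have nu_ge0 B : (0 <= mu_beta beta P B)%E.
  rewrite mule_ge0 ?lee_fin//; apply: integral_ge0 => r _.
  by rewrite mule_ge0.
have nu_sigma : semi_sigma_additive (mu_beta beta P).
  move=> F mF tF mUF.
  have -> : mu_beta beta P (\bigcup_n F n) =
      (\sum_(0 <= n <oo) mu_beta beta P (F n))%E.
    rewrite /mu_beta.
    rewrite nneseriesZl//; last first.
      by move=> n _; apply: integral_ge0 => r _; rewrite mule_ge0.
    rewrite -integral_nneseries//; last 2 first.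
      by move=> n; exact: mw.
      by move=> n r _; rewrite mule_ge0.
    congr (_ * _)%E; apply: eq_integral => r _.
    by rewrite nneseriesZl// measure_semi_bigcup.
  exact: is_cvg_nneseries.
by exists (HB.pack_for {measure set Mp -> \bar R} (mu_beta beta P)
  (isMeasure.Build _ _ _ (mu_beta beta P) nu0 nu_ge0 nu_sigma)).
Qed.
End mixture.

(** * Odd events *)

Section odd_event_law.
Context d (E : measurableType d) (R : realType).
Local Notation Mp := (point_measure E R).
Variables (nu : {measure set E -> \bar R}) (P : probability Mp R).
Hypothesis nuP : is_poisson_point_law nu P.

Lemma poisson_odd_event (A : set E) : measurable A -> (nu A < +oo)%E ->
  P (odd_event R A) = ((1 - expR (- 2 * fine (nu A))) / 2)%:E.
Proof.
move=> mA nuA; rewrite odd_event_bigcup measure_bigcup/=; last 2 first.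
- by move=> k _; exact: measurable_point_measure_eq.
- by move=> k l _ _ [m /= [-> /eqP]]; rewrite eqe eqr_nat => /eqP.
rewrite -poisson_mass_odd_series ?fine_ge0//.
rewrite (@eq_eseriesl _ _ odd); last by move=> k; apply/idP/idP; rewrite inE.
apply: eq_eseriesr => k _.
by have := poisson_point_lawE nuP (Some k) mA; rewrite /= nuA.
Qed.

(* Where both [m A] and [m B] are finite,
   [m A + m B = m (A `+` B) + 2 * m (A `&` B)]. *)
Lemma poisson_odd_event_symdiff (A B : set E) : measurable A -> measurable B ->
  (nu A < +oo)%E -> (nu B < +oo)%E ->
  P (odd_event R A `+` odd_event R B) = P (odd_event R (A `+` B)).
Proof.
move=> mA mB nuA nuB.
have mAB : measurable (A `+` B) by apply: measurableU; exact: measurableD.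
pose N := [set m : Mp | m A = +oo%E] `|` [set m : Mp | m B = +oo%E].
have mN : measurable N.
  by apply: measurableU; exact: measurable_point_measure_eq.
have mO (C : set E) : measurable C -> measurable (odd_event R C).
  exact: measurable_odd_event.
have PN0 : P N = 0%E.
  apply: null_set_setU; try exact: measurable_point_measure_eq.
  - by have := poisson_point_lawE nuP None mA; rewrite /= nuA.
  - by have := poisson_point_lawE nuP None mB; rewrite /= nuB.
have mS : measurable (odd_event R A `+` odd_event R B).
  by apply: measurableU; apply: measurableD; exact: mO.
(* Adjoining the null event [N] to both sides leaves the probabilities unchanged, so the events need
   only agree off [N]. *)
rewrite -(measureU0 mS mN PN0) -(measureU0 (mO _ mAB) mN PN0).
congr (P _); apply/seteqP.
suff e (m : Mp) : ~ N m ->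
    (odd_event R A `+` odd_event R B) m <-> odd_event R (A `+` B) m.
  by split=> m [Um|]; try (by right);
    have [|/e em] := pselect (N m); try (by right); left; exact/em.
move=> /not_orP[/= mAoo mBoo].
have mAD : m A = (m (A `\` B) + m (A `&` B))%E := measureDI m mA mB.
have mBD : m B = (m (B `\` A) + m (B `&` A))%E := measureDI m mB mA.
have mABD : m (A `+` B) = (m (A `\` B) + m (B `\` A))%E.
  rewrite measureU//; [exact: measurableD|exact: measurableD|].
  by apply/seteqP; split=> // x [[? ?] []].
have [a ma] := point_measure_ext_nat m (measurableD mA mB).
have [b mb] := point_measure_ext_nat m (measurableD mB mA).
have [c mc] := point_measure_ext_nat m (measurableI _ _ mA mB).
rewrite ma mc in mAD; rewrite mb setIC mc in mBD; rewrite ma mb in mABD.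
(* Off [N] the three masses are finite, each being a summand of [m A] or [m B]. *)
case: a b c {ma mb mc} => [a|] [b|] [c|] in mAD mBD mABD *;
  try by case: mAoo; rewrite mAD.
rewrite /= -EFinD -natrD in mAD; rewrite /= -EFinD -natrD in mBD.
rewrite /= -EFinD -natrD in mABD.
have oddE C n : m C = n%:R%:E -> odd_event R C m <-> odd n.
  move=> mC; split=> [[k ok]|on]; last by exists n.
  by rewrite mC => -[] /eqP; rewrite eqr_nat => /eqP ->.
rewrite /setY /= (oddE _ _ mAD) (oddE _ _ mBD) (oddE _ _ mABD) !oddD.
by case: (odd a) (odd b) (odd c) => [] [] [] /=; intuition.
Qed.
End odd_event_law.

(** With [t] the measure of [A], the integral is [(2t)^beta * Gamma(1 - beta) / (2 * beta)], and
    [c_beta] is exactly the factor that turns this into [t^beta]. *)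
Lemma mu_beta_odd_event d (E : measurableType d) (R : realType)
    (mu : {measure set E -> \bar R})
    (P : R -> probability (point_measure E R) R)
    (P_poisson : forall (r : R) (r_gt0 : 0 < r),
       is_poisson_point_law (mscale (NngNum (ltW r_gt0)) mu) (P r))
    (beta : R) (A : set E) :
  0 < beta < 1 -> measurable A -> (mu A < +oo)%E ->
  mu_beta beta P (odd_event R A) = (fine (mu A) `^ beta)%:E.
Proof.
move=> /andP[b0 b1] mA muA; rewrite /mu_beta.
set t := fine (mu A).
have t0 : 0 <= t by exact: fine_ge0.
have muAE : mu A = t%:E by rewrite fineK// ge0_fin_numE.
have b01 : 0 < beta < 1 by rewrite b0.
have st0 : 0 <= 2 * t by rewrite mulr_ge0.
rewrite (_ : \int[lebesgue_measure]_(r in _) _ =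
  \int[lebesgue_measure]_(r in `]0%R, +oo[)
    ((2^-1)%:E * (r `^ (- beta - 1) * (1 - expR (- (2 * t) * r)))%:E))%E;
  last first.
  apply: eq_integral => r; rewrite inE/= in_itv/= andbT => r0.
  rewrite (poisson_odd_event (P_poisson r r0))//=; last first.
    by rewrite /mscale/= muAE -EFinM ltry.
  rewrite /mscale/= muAE -!EFinM /=; congr EFin.
  by rewrite [- (2 * t) * r](_ : _ = -2 * (r * t)); [rewrite mulrA mulrC|ring].
rewrite ge0_integralZl_EFin//; last 2 first.
- move=> r; rewrite /= in_itv/= andbT => r0.
  rewrite lee_fin mulr_ge0 ?powR_ge0// subr_ge0 -[leRHS]expR0 ler_expR.
  by rewrite mulNr oppr_le0 mulr_ge0// ltW.
- apply/measurable_EFinP/measurable_funTS; apply: measurable_funM.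
    exact: measurable_powR.
  apply: measurable_funB => //; apply: (measurableT_comp (@measurable_expR R)).
  exact: mulrl_measurable.
rewrite integral_powR_expR// -!EFinM; congr EFin.
have G0 := Gamma_gt0 b01.
(* Splitting off [2^beta] leaves it as an atom that [field] can cancel. *)
have h2 : 2 `^ (1 - beta) = 2 / 2 `^ beta :> R.
  by rewrite powRB ?powRr1// pnatr_eq0 implybT.
rewrite /c_beta powRM// h2.
have e0 : 0 < 2 `^ beta :> R by rewrite powR_gt0.
by field; rewrite ?gt_eqF.
Qed.

Theorem proposition4p1 (R : realType) (M : metricType R)
    (d : measure_display) (E : measurableType d)
    (mu : {measure set E -> \bar R}) (A : M -> set E)
    (P : R -> probability (point_measure E R) R)
    (mu_sigma_finite : sigma_finite [set: E] mu)
    (measurable_A : forall x, measurable (A x))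
    (A_fin : forall x, (mu (A x) < +oo)%E)
    (mdist_mu : forall x y, (mdist x y)%:E = mu (A x `+` A y))
    (P_poisson : forall (r : R) (r_gt0 : 0 < r),
       is_poisson_point_law (mscale (NngNum (ltW r_gt0)) mu) (P r)) :
  forall beta : R, 0 < beta < 1 ->
  exists nu : {measure set (point_measure E R) -> \bar R},
    [/\ forall B, measurable B -> nu B = mu_beta beta P B,
        forall x, measurable (odd_event R (A x))
      & forall x y, (mdist x y `^ beta)%:E =
          nu (odd_event R (A x) `+` odd_event R (A y))].
Proof.
move=> beta b01; have /andP[b0 b1] := b01.
have [nu nuE] : exists nu : {measure set (point_measure E R) -> \bar R},
    forall B, measurable B -> nu B = mu_beta beta P B.
  apply: (mu_beta_measure P_poisson).
  rewrite /c_beta divr_ge0 ?(ltW (Gamma_gt0 b01))// mulr_ge0 ?powR_ge0//.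
  exact: ltW.
have mO x : measurable (odd_event R (A x)) by exact: measurable_odd_event.
exists nu; split => // x y.
have mD : measurable (A x `+` A y) by apply: measurableU; exact: measurableD.
have muD : (mu (A x `+` A y) < +oo)%E by rewrite -mdist_mu ltry.
rewrite nuE; last by apply: measurableU; apply: measurableD.
rewrite (_ : mdist x y = fine (mu (A x `+` A y))); last by rewrite -mdist_mu.
(* The power of the distance becomes the [mu_beta] mass of the odd event of [A x]+[A y]; the two
   integrands are then compared at each [r > 0]. *)
rewrite -(mu_beta_odd_event P_poisson)// /mu_beta; congr (_ * _)%E.
apply: eq_integral => r; rewrite inE/= in_itv/= andbT => r0; congr (_ * _)%E.
have fin z : (mscale (NngNum (ltW r0)) mu (A z) < +oo)%E.
  by rewrite /mscale/= lte_mul_pinfty// lee_fin ltW.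
apply/esym.
exact: (poisson_odd_event_symdiff (P_poisson r r0) (measurable_A x)
  (measurable_A y) (fin x) (fin y)).
Qed.
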